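(* Suppose that $\eta^2(\nu)$ is quadratic in $\nu$, that $m_1(\nu)$ and $\eta(\nu)m_2(\nu)$ are linear in $\nu$, and that $m_2^2(\nu)$ is a constant. Suppose $h(\nu)$ is conjectured in the exponential-polynomial form such that $$\omega(x,\nu)=\frac{x^{1-\gamma}}{1-\gamma}h(\nu)^{1-\gamma}=\frac{x^{1-\gamma}}{1-\gamma}\exp\left\{(1-\gamma)\left(A_0+\sum_{k=1}^n\frac1kA_k\nu^k\right)\right\},$$ where $A_k$, $k=0,\dots,n$, are constants. Then the equation $$r-\beta+\frac{1}{2\gamma}\eta^2(\nu)+\beta(\ln\beta-\ln h)+\left[m_1(\nu)+\frac{\eta(\nu)}{\gamma}\rho m_2(\nu)(1-\gamma)\right]\frac{h_\nu}{h}+\frac12m_2^2(\nu)\left[\frac{\rho^2(1-\gamma)^2}{\gamma}-\gamma\right]\frac{h_\nu^2}{h^2}+\frac12m_2^2(\nu)\frac{h_{\nu\nu}}{h}=0$$ has no analytical solutions (of this form) when the order $n$ of the polynomial is higher than $2$.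
   Context: Parameters: $r>0$, $\beta>0$, $\gamma>0$ with $\gamma\neq1$, $\rho\in[-1,1]$; $\eta,m_1,m_2$ are real functions of the state variable $\nu$, where $d\nu_t=m_1(\nu_t)dt+m_2(\nu_t)dW^\nu_t$, $m_2$ is the volatility of the state variable and $\eta(\nu_t)$ is the market price of risk. ''Linear in $\nu$'' means a first-order polynomial $a+b\nu$. The displayed equation is to hold identically in $\nu$ on the state space. It arises from the infinite-horizon consumption–investment problem with recursive utility and unit elasticity of intertemporal substitution: it is obtained by inserting the first-order conditions and the ansatz $\omega(x,\nu)=\frac{x^{1-\gamma}}{1-\gamma}h(\nu)^{1-\gamma}$ into the HJB equation. The polynomial $A_0+\sum_{k=1}^n\frac1kA_k\nu^k$ has order $n$ when $A_n\neq0$. An ''analytical solution'' means a function $h=\exp\{A_0+\sum_{k=1}^n\frac1kA_k\nu^k\}$ of the stated form satisfying the equation.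
   Formalization: The volatility m_2 is assumed nonzero: if m_2=0 the claim fails, e.g. with η=0, m_1(ν)=(β/n)ν, the function h=exp{A_0+A_nν^n/n} with A_0=(r-β+β ln β)/β solves the equation for every n. *)

(* Defs.v *)
From HB Require Import structures.
From mathcomp Require Import all_boot all_order all_algebra.
From mathcomp Require Import all_classical all_reals all_analysis.
Import Order.TTheory GRing.Theory Num.Theory.
Import numFieldNormedType.Exports.

Set Implicit Arguments.
Unset Strict Implicit.
Unset Printing Implicit Defensive.

Local Open Scope classical_set_scope.
Local Open Scope ring_scope.

Definition linear_on (R : realType) (D : set R) (f : R -> R) : Prop :=
  exists a b : R, forall nu, D nu -> f nu = a + b * nu.

(* The leading coefficients in [linear_on] and [quadratic_on] may vanish. *)
Definition quadratic_on (R : realType) (D : set R) (f : R -> R) : Prop :=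
  exists a b c : R, forall nu, D nu -> f nu = a + b * nu + c * nu ^+ 2.

Definition constant_on (R : realType) (D : set R) (f : R -> R) : Prop :=
  exists a : R, forall nu, D nu -> f nu = a.

(* A deterministic state variable has to be excluded: with [m2 = 0], [eta = 0]
   and [m1 nu = beta / n * nu], the function [expR (A0 + A * nu ^+ n)] solves
   the equation for a suitable [A0], every [A] and every [n]. *)
Definition nondegenerate_on (R : realType) (D : set R) (m2 : R -> R) : Prop :=
  forall nu, D nu -> m2 nu != 0.

Definition exponent (R : realType) (n : nat) (A : nat -> R) (nu : R) : R :=
  A 0%N + \sum_(1 <= k < n.+1) k%:R^-1 * A k * nu ^+ k.

Definition exp_poly_form (R : realType) (D : set R) (n : nat) (A : nat -> R)
    (h : R -> R) : Prop :=
  forall nu, D nu -> h nu = expR (exponent n A nu).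

Definition omega (R : realType) (gamma : R) (h : R -> R) (x nu : R) : R :=
  x `^ (1 - gamma) / (1 - gamma) * h nu `^ (1 - gamma).

(* For positive [h], the form of [h] and the form of the value function
   [omega] on positive wealth determine each other. *)
Lemma exp_poly_form_omega (R : realType) (gamma : R) (D : set R) (n : nat)
    (A : nat -> R) (h : R -> R) :
  gamma != 1 -> (forall nu, D nu -> 0 < h nu) ->
  exp_poly_form D n A h <->
  (forall x nu, 0 < x -> D nu ->
     omega gamma h x nu =
     x `^ (1 - gamma) / (1 - gamma) * expR ((1 - gamma) * exponent n A nu)).
Proof.
move=> g1 h0; have g1' : 1 - gamma != 0 by rewrite subr_eq0 eq_sym.
split=> [hE x nu x0 Dnu | hE nu Dnu].
  by rewrite /omega hE// /powR (negbTE (lt0r_neq0 (expR_gt0 _))) expRK.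
have := hE 1 nu ltr01 Dnu; rewrite /omega powR1 => /mulfI.
have -> : 1 / (1 - gamma) != 0 by rewrite mul1r invr_eq0.
move=> /(_ isT).
rewrite /powR (negbTE (lt0r_neq0 (h0 _ Dnu))) => /expR_inj /(mulfI g1') <-.
by rewrite lnK// posrE h0.
Qed.

Definition hjb_lhs (R : realType) (r beta gamma rho : R)
    (eta m1 m2 h : R -> R) (nu : R) : R :=
  r - beta + (2 * gamma)^-1 * eta nu ^+ 2 + beta * (ln beta - ln (h nu))
  + (m1 nu + eta nu / gamma * rho * m2 nu * (1 - gamma))
    * ((h^`())%classic nu / h nu)
  + 2^-1 * m2 nu ^+ 2 * (rho ^+ 2 * (1 - gamma) ^+ 2 / gamma - gamma)
    * ((h^`())%classic nu ^+ 2 / h nu ^+ 2)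
  + 2^-1 * m2 nu ^+ 2 * ((h^`(2))%classic nu / h nu).

(* The state space [D] is taken open, so that the values of [h] on [D]
   determine its derivatives there. *)
Definition analytical_solution (R : realType) (D : set R)
    (r beta gamma rho : R) (eta m1 m2 : R -> R) (n : nat) (A : nat -> R)
    (h : R -> R) : Prop :=
  exp_poly_form D n A h /\
  forall nu, D nu -> hjb_lhs r beta gamma rho eta m1 m2 h nu = 0.

(* Main.v *)
Require Import Defs.
From HB Require Import structures.
From mathcomp Require Import all_boot all_order all_algebra.
From mathcomp Require Import all_classical all_reals all_analysis.
From mathcomp Require Import ring lra.
From mathcomp Require Import polyorder.
Import Order.TTheory GRing.Theory Num.Theory.
Import numFieldNormedType.Exports.

(** Write [h = expR p] with [p] a polynomial of degree [n].  Then
    [h'/h = p'] and [h''/h = p'' + p' ^ 2], while [ln h = p], so the equation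
    has the shape of a Riccati equation for [p'], with the extra term
    [- beta * p], and its coefficients are polynomials: the term [eta ^ 2]
    has degree at most 2, the drift has degree at most 1 and [m2 ^ 2] is a constant [v].  The two second-order terms both
    contribute to [p' ^ 2], whose coefficient is altogether
    [v / 2 * (rho ^ 2 * (1 - gamma) ^ 2 / gamma - gamma + 1)].  It is nonzero
    ([quadratic_coef_neq0]): up to the factor [(1 - gamma) / gamma], the
    bracket is [rho ^ 2 * 1 + (1 - rho ^ 2) * gamma], a convex combination of
    two positive numbers.

    Hence [p' ^ 2] brings in degree [2 * n - 2], while all the other terms have
    degree at most [max n 2].  For [n > 2] the first is strictly larger, so the
    left-hand side is a nonzero polynomial ([riccati_poly_neq0]), which cannot
    vanish on a nonempty open set ([poly_eq0_open]). *)

Set Implicit Arguments.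
Unset Strict Implicit.
Unset Printing Implicit Defensive.

Local Open Scope classical_set_scope.
Local Open Scope ring_scope.

(** The square has degree [2 * deg p - 2] and dominates the other terms, of
    degree at most [deg p], exactly when [deg p > 2]. *)
Lemma riccati_poly_neq0 (F : realFieldType) (p Q L : {poly F}) (b d c : F) :
  c != 0 -> (3 < size p)%N -> (size Q <= 3)%N -> (size L <= 2)%N ->
  Q + b *: p + L * p^`() + d *: p^`()^`() + c *: p^`() ^+ 2 != 0.
Proof.
move=> c0 sp sQ sL.
have [m szp] : exists m, size p = m.+4.
  by exists (size p - 4)%N; rewrite -addn4 subnK.
have szp' : size p^`() = m.+3 by rewrite size_deriv szp.
have p'0 : p^`() != 0 by rewrite -size_poly_gt0 szp'.
have szS : size (c *: p^`() ^+ 2) = (m + m.+1).+4.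
  by rewrite size_scale// expr2 size_mul// szp' addSn /= !addnS.
have szR : (size (Q + b *: p + L * p^`() + d *: p^`()^`())%R <= m.+4)%N.
  have leD (u v : {poly F}) : (size u <= m.+4)%N -> (size v <= m.+4)%N ->
      (size (u + v)%R <= m.+4)%N.
    by move=> hu hv; rewrite (leq_trans (size_polyD _ _))// geq_max hu.
  do !apply: (leD).
  - exact: leq_trans sQ _.
  - by rewrite -szp size_scale_leq.
  - rewrite (leq_trans (size_polyMleq _ _))// szp' addnS /=.
    by rewrite (leq_add sL (leqnn m.+2)).
  - by rewrite (leq_trans (size_scale_leq _ _))// size_deriv szp' ltnW.
rewrite -size_poly_gt0 addrC size_polyDl szS//.
by rewrite (leq_ltn_trans szR)// !ltnS addnS ltnS leq_addr.
Qed.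

(** A nonempty open set has more points than a nonzero polynomial has roots. *)
Lemma poly_eq0_open (R : realType) (D : set R) (p : {poly R}) :
  open D -> D !=set0 -> (forall x, D x -> p.[x] = 0) -> p = 0.
Proof.
move=> oD [x Dx] p0.
have /nbhs_ballP[e /= e0 De] : nbhs x D by exact: open_nbhs_nbhs.
(* The shift by 2 keeps the points at distance less than [e] from [x]. *)
pose s := mkseq (fun i => x + e / i.+2%:R) (size p).
apply: (@roots_geq_poly_eq0 _ _ s); last by rewrite size_mkseq.
- apply/allP => _ /mapP[i _ ->]; apply/rootP/p0/De.
  rewrite /ball /= opprD addNKr normrN gtr0_norm ?divr_gt0//.
  by rewrite ltr_pdivrMr// ltr_pMr// ltr1n.
- apply: mkseq_uniq => i j /addrI /(mulfI (lt0r_neq0 e0)) /invr_inj /eqP.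
  by rewrite eqr_nat => /eqP[].
Qed.

Lemma derive1_eq_open (R : realType) (D : set R) (f g : R -> R) (x : R) :
  open D -> D x -> (forall y, D y -> f y = g y) ->
  (f^`())%classic x = (g^`())%classic x.
Proof.
move=> oD Dx fg; rewrite !derive1E; apply: near_eq_derive.
by near=> y; apply: fg; near: y; exact: open_nbhs_nbhs.
Unshelve. all: by end_near. Qed.

(** The weight [q] makes the statement stable under differentiation: starting
    from [q = 1], it yields the derivatives of [expR p] of every order. *)
Lemma derive1_poly_expR (R : realType) (p q : {poly R}) :
  ((fun x => q.[x] * expR p.[x])^`())%classic =
  (fun x => (q^`() + q * p^`()).[x] * expR p.[x]).
Proof.
have dh (s : {poly R}) (x : R) : is_derive x 1 (horner s) s^`().[x].
  by rewrite derivE derive1E; apply: DeriveDef => //; exact: derivable_horner.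
apply/funext => x; rewrite derive1E.
have -> : (fun x => q.[x] * expR p.[x]) = horner q * (expR \o horner p) by [].
rewrite derive_val /GRing.scale /= hornerD hornerM; ring.
Qed.

(** The order-0 coefficient is singled out because the exponent carries [A 0]
    without the factor [1 / k], and [0%:R^-1 = 0]. *)
Definition exponent_poly (R : realType) (n : nat) (A : nat -> R) : {poly R} :=
  \poly_(k < n.+1) (if k == 0 then A 0 else k%:R^-1 * A k).

Lemma horner_exponent_poly (R : realType) (n : nat) (A : nat -> R) (x : R) :
  (exponent_poly n A).[x] = exponent n A x.
Proof.
rewrite horner_poly /exponent -(big_mkord xpredT
  (fun k => (if k == 0 then A 0 else k%:R^-1 * A k) * x ^+ k)).
rewrite big_ltn//= expr0 mulr1; congr (_ + _).
by apply: eq_big_nat => -[].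
Qed.

Lemma size_exponent_poly (R : realType) (n : nat) (A : nat -> R) :
  (0 < n)%N -> A n != 0 -> size (exponent_poly n A) = n.+1.
Proof.
case: n => // n _ An; rewrite size_poly_eq//=.
by rewrite mulf_neq0// invr_neq0// pnatr_eq0.
Qed.

Lemma quadratic_coef_neq0 (F : realFieldType) (gamma rho : F) :
  0 < gamma -> gamma != 1 -> -1 <= rho <= 1 ->
  rho ^+ 2 * (1 - gamma) ^+ 2 / gamma - gamma + 1 != 0.
Proof.
move=> g0 g1 /andP[r1 r2].
(* Factored so, the middle factor is a convex combination of 1 and [gamma]. *)
have -> : rho ^+ 2 * (1 - gamma) ^+ 2 / gamma - gamma + 1 =
    (1 - gamma) * (rho ^+ 2 + gamma * (1 - rho ^+ 2)) / gamma.
  by field; rewrite gt_eqF.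
rewrite !mulf_neq0 ?invr_eq0 ?(gt_eqF g0)// ?subr_eq0 1?eq_sym//.
have rho2 : rho ^+ 2 <= 1 by nra.
rewrite lt_eqF//.
have [->|rho0] := eqVneq rho 0; first by rewrite expr0n /=; lra.
have : 0 < rho ^+ 2 by rewrite exprn_even_gt0.
nra.
Qed.

Theorem theorem4p2 (R : realType) (r beta gamma rho : R)
    (D : set R) (eta m1 m2 : R -> R) :
  0 < r -> 0 < beta -> 0 < gamma -> gamma != 1 -> -1 <= rho <= 1 ->
  open D -> is_interval D -> D !=set0 ->
  quadratic_on D (fun nu => eta nu ^+ 2) ->
  linear_on D m1 ->
  linear_on D (fun nu => eta nu * m2 nu) ->
  constant_on D (fun nu => m2 nu ^+ 2) ->
  nondegenerate_on D m2 ->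
  forall n : nat, (2 < n)%N ->
  ~ exists (A : nat -> R) (h : R -> R),
      A n != 0 /\ analytical_solution D r beta gamma rho eta m1 m2 n A h.
Proof.
move=> _ _ g0 g1 rho1 oD _ D0 [e0 [e1 [e2 etaE]]] [a [b m1E]] [a' [b' emE]].
move=> [v m2E] m20 n n2 [A [h [An [hE hjb]]]].
set p := exponent_poly n A.
have sp : size p = n.+1 by rewrite size_exponent_poly// (ltn_trans _ n2).
have hexp x : D x -> h x = expR p.[x].
  by move=> Dx; rewrite hE// -horner_exponent_poly.
have h1 x : D x -> (h^`())%classic x = p^`().[x] * expR p.[x].
  move=> Dx; rewrite (derive1_eq_open (g := fun x => 1.[x] * expR p.[x]) oD Dx)//.
    by rewrite derive1_poly_expR -polyC1 derivC add0r mul1r.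
  by move=> y Dy; rewrite hexp// hornerE mul1r.
have h2 x : D x -> (h^`(2))%classic x = (p^`()^`() + p^`() ^+ 2).[x] * expR p.[x].
  move=> Dx; rewrite derive1nS derive1n1 (derive1_eq_open oD Dx h1).
  by rewrite derive1_poly_expR expr2.
have v0 : v != 0 by case: D0 => x Dx; rewrite -(m2E x Dx) expf_neq0// m20.
pose c := 2^-1 * v * (rho ^+ 2 * (1 - gamma) ^+ 2 / gamma - gamma + 1).
have c0 : c != 0 by rewrite !mulf_neq0 ?invr_eq0 ?pnatr_eq0 ?quadratic_coef_neq0.
(* The drift coefficient is [m1 + k * (eta * m2)]. *)
pose k := rho * (1 - gamma) / gamma.
pose Q := Poly [:: r - beta + beta * ln beta + (2 * gamma)^-1 * e0;
  (2 * gamma)^-1 * e1; (2 * gamma)^-1 * e2].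
pose L := Poly [:: a + k * a'; b + k * b'].
have := @riccati_poly_neq0 _ p Q L (- beta) (2^-1 * v) c c0.
rewrite sp ltnS n2 !(leq_trans (size_Poly _))// => /(_ isT isT isT).
move=> /eqP; apply; apply: (poly_eq0_open oD D0) => x Dx.
rewrite -(hjb x Dx) /hjb_lhs etaE// m2E// h1// h2// hexp// expRK m1E//.
have -> : eta x / gamma * rho * m2 x * (1 - gamma) = k * (a' + b' * x).
  by rewrite -emE// /k; ring.
rewrite exprMn !mulfK ?expf_neq0 ?gt_eqF ?expR_gt0//.
rewrite !(hornerD, hornerM, hornerZ, horner_exp, horner_Poly) /= /c.
ring.
Qed.
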